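(* Let $G$ be a prime $C_5$-free graph. (i) If $G$ contains an induced $P_5$, then $G$ is $(P_5,\overline{P_5},Bull)$-sparse if and only if $G$ is isomorphic to a graph of one of the two types (bundle of $P_5$'s, or graph of the second type) described in the context. (ii) If $G$ contains an induced $\overline{P_5}$, then $G$ is $(P_5,\overline{P_5},Bull)$-sparse if and only if $\overline{G}$ is isomorphic to a graph of one of these two types.
   Context: All graphs are finite, simple and undirected; $\overline{G}$ denotes the complement of $G$. $P_5$ is the chordless path on $5$ vertices, $\overline{P_5}$ its complement, $C_5$ the chordless cycle on $5$ vertices, and the Bull is the graph on $\{1,2,3,4,5\}$ with edges $12,23,34,25,35$. A graph is $C_5$-free if it has no induced subgraph isomorphic to $C_5$. A graph $G$ is $(P_5,\overline{P_5},Bull)$-sparse if every set of $6$ vertices of $G$ contains at most one $5$-element subset inducing a graph isomorphic to $P_5$, $\overline{P_5}$ or the Bull. A module of a graph $G=(V,E)$ is a set $M\subseteq V$ such that every vertex outside $M$ is adjacent either to all vertices of $M$ or to none of them. $G$ is prime if its only modules are $\emptyset$, the singletons, and $V$. The two types of graphs are the following. Bundle of $P_5$'s: for some integer $k\ge 2$, the graph with a vertex $x$, vertices $u_1,\dots,u_k,v_1,\dots,v_k$, and possibly one additional (optional) vertex $y$; the edges are $xu_i$ and $u_iv_i$ for $1\le i\le k$, together with $xy$ if $y$ is present, and there are no other edges. Second type: the graph with vertices $a,b,c,d,e,x_0,t_0$ and possibly one additional (optional) vertex $x$; the edges are $ab,bc,cd,de$, the edges $t_0a,t_0b,t_0c,t_0d,t_0e$,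 the edge $cx_0$, and, if $x$ is present, the edges $xc,xx_0,xt_0$; there are no other edges (in particular $x_0$ and $t_0$ are non-adjacent). *)

(* Defs.v *)
From HB Require Import structures.
From mathcomp Require Import all_boot.

Set Implicit Arguments.
Unset Strict Implicit.
Unset Printing Implicit Defensive.

Record sgraph := SGraph {
  vertex :> finType;
  adj : rel vertex;
  adj_sym : symmetric adj;
  adj_irr : irreflexive adj
}.

Definition isomorphic (G H : sgraph) : Prop :=
  exists f : G -> H, bijective f /\ forall x y, adj (f x) (f y) = adj x y.

Section Constructions.
Variable G : sgraph.

Definition compl_adj : rel G := fun x y => (x != y) && ~~ adj x y.

Lemma compl_adj_sym : symmetric compl_adj.
Proof. by move=> x y; rewrite /compl_adj eq_sym adj_sym. Qed.

Lemma compl_adj_irr : irreflexive compl_adj.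
Proof. by move=> x; rewrite /compl_adj eqxx. Qed.

Definition compl : sgraph := SGraph compl_adj_sym compl_adj_irr.

Variable A : {set G}.

Definition induced_adj : rel {x : G | x \in A} := fun x y => adj (val x) (val y).

Lemma induced_adj_sym : symmetric induced_adj.
Proof. by move=> x y; apply: adj_sym. Qed.

Lemma induced_adj_irr : irreflexive induced_adj.
Proof. by move=> x; apply: adj_irr. Qed.

Definition induced : sgraph := SGraph induced_adj_sym induced_adj_irr.

End Constructions.

Definition contains_induced (G H : sgraph) : Prop :=
  exists A : {set G}, isomorphic (induced A) H.

(* The graph on {0, ..., n-1} whose edges are the unordered pairs listed in s;
   pairs involving a number >= n have no effect. *)
Section EdgeList.
Variables (n : nat) (s : seq (nat * nat)).

Definition edges_adj : rel 'I_n := fun i j =>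
  (i != j) && (((val i, val j) \in s) || ((val j, val i) \in s)).

Lemma edges_adj_sym : symmetric edges_adj.
Proof. by move=> i j; rewrite /edges_adj eq_sym orbC. Qed.

Lemma edges_adj_irr : irreflexive edges_adj.
Proof. by move=> i; rewrite /edges_adj eqxx. Qed.

Definition graph_of_edges : sgraph := SGraph edges_adj_sym edges_adj_irr.

End EdgeList.

Definition P5 : sgraph := graph_of_edges 5 [:: (0, 1); (1, 2); (2, 3); (3, 4)].

Definition C5 : sgraph :=
  graph_of_edges 5 [:: (0, 1); (1, 2); (2, 3); (3, 4); (4, 0)].

Definition Bull : sgraph :=
  graph_of_edges 5 [:: (0, 1); (1, 2); (2, 3); (1, 4); (2, 4)].

Definition C5_free (G : sgraph) : Prop := ~ contains_induced G C5.

Definition P5_coP5_Bull_set (G : sgraph) (A : {set G}) : Prop :=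
  #|A| = 5 /\ (isomorphic (induced A) P5 \/
               isomorphic (induced A) (compl P5) \/
               isomorphic (induced A) Bull).

Definition P5_coP5_Bull_sparse (G : sgraph) : Prop :=
  forall S : {set G}, #|S| = 6 ->
  forall A B : {set G}, A \subset S -> B \subset S ->
    P5_coP5_Bull_set A -> P5_coP5_Bull_set B -> A = B.

Definition is_module (G : sgraph) (M : {set G}) : Prop :=
  forall z, z \notin M ->
    (forall m, m \in M -> adj z m) \/ (forall m, m \in M -> ~~ adj z m).

Definition prime_graph (G : sgraph) : Prop :=
  forall M : {set G}, is_module M ->
    M = set0 \/ (exists x, M = [set x]) \/ M = [set: G].

(* 'I_opt, with the boolean opt read as 0 or 1, holds the optional vertex y. *)
Section Bundle.
Variables (k : nat) (opt : bool).

Inductive bundle_role := BX | BY | BU of 'I_k | BV of 'I_k.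

Definition bundle_vertex : finType := (unit + 'I_opt + ('I_k + 'I_k))%type.

Definition role (p : bundle_vertex) : bundle_role :=
  match p with
  | inl (inl _) => BX
  | inl (inr _) => BY
  | inr (inl i) => BU i
  | inr (inr i) => BV i
  end.

Definition bundle_adj : rel bundle_vertex := fun p q =>
  match role p, role q with
  | BX, BU _ | BU _, BX => true
  | BU i, BV j | BV j, BU i => i == j
  | BX, BY | BY, BX => true
  | _, _ => false
  end.

Lemma bundle_adj_sym : symmetric bundle_adj.
Proof. by move=> p q; rewrite /bundle_adj; case: (role p); case: (role q). Qed.

Lemma bundle_adj_irr : irreflexive bundle_adj.
Proof. by move=> p; rewrite /bundle_adj; case: (role p). Qed.

Definition P5_bundle : sgraph := SGraph bundle_adj_sym bundle_adj_irr.

End Bundle.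

(* a, b, c, d, e are 0, 1, 2, 3, 4; x0 is 5, t0 is 6, and the optional vertex x
   is 7, which exists exactly when opt = true. *)
Definition second_graph (opt : bool) : sgraph :=
  graph_of_edges (7 + opt)
    [:: (0, 1); (1, 2); (2, 3); (3, 4);
        (6, 0); (6, 1); (6, 2); (6, 3); (6, 4);
        (2, 5);
        (7, 2); (7, 5); (7, 6)].

Definition of_two_types (G : sgraph) : Prop :=
  (exists (k : nat) (opt : bool), 2 <= k /\ isomorphic G (P5_bundle k opt)) \/
  (exists opt : bool, isomorphic G (second_graph opt)).

(* Main.v *)
Require Import Defs.
From mathcomp Require Import all_boot.

(* Complementation exchanges (i) and (ii), the Bull being self-complementary, so
   only (i) matters. Fix an induced P5 abcde in a prime sparse graph. Inspecting
   six vertices, every other vertex sees nothing of it, only its middle c, or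
   all of it; call these vertices anti, pend and full. Seven or eight vertices
   suffice to see that the edges between anti and pend form an isolated
   matching whose vertices are complete to the full ones, that anti and pend
   interact with full monotonically, and that two disjoint nonadjacent
   (pend, full) pairs cannot coexist. If pend is complete to full, then abcde,
   the pend vertices and the matched anti vertices form a module, hence
   everything, and the unmatched pend vertices form another one: G is a bundle.
   Otherwise, for a nonadjacent pair (x0, t0), the set made of abcde, pend and
   the full vertices missing some pend vertex is a module, hence everything, so
   t0 is the only full vertex and pend minus x0 is a module: G is of the second
   type. *)

Set Implicit Arguments.
Unset Strict Implicit.
Unset Printing Implicit Defensive.

(** * Isomorphisms, induced subgraphs and listed copies of patterns *)

Lemma isomorphic_sym (G H : sgraph) : isomorphic G H -> isomorphic H G.
Proof.
case=> f [[g fK gK] fadj]; exists g; split; first by exists f.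
by move=> x y; rewrite -fadj !gK.
Qed.

Lemma isomorphic_trans (G H K : sgraph) :
  isomorphic G H -> isomorphic H K -> isomorphic G K.
Proof.
move=> [f [fbij fadj]] [g [gbij gadj]]; exists (g \o f).
by split; [apply: bij_comp | move=> x y; rewrite /= gadj].
Qed.

Lemma isomorphic_inducedP (G H : sgraph) (A : {set G}) :
  isomorphic (induced A) H <->
  exists f : H -> G, [/\ injective f, forall x y, adj (f x) (f y) = adj x y
                       & A = f @: [set: H]].
Proof.
split=> [[g [[g' gK g'K] gadj]] | [f [finj fadj defA]]].
  exists (fun x => val (g' x)); split=> [x y /val_inj/(can_inj g'K) //|x y|].
    by rewrite -[x in RHS]g'K -[y in RHS]g'K gadj.
  apply/setP=> x; apply/idP/imsetP=> [Ax | [y _ ->]]; last exact: valP.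
  by exists (g (Sub x Ax)); rewrite ?inE ?gK ?SubK.
have fA x : f x \in A by rewrite defA imset_f ?inE.
pose h x : induced A := Sub (f x) (fA x).
have hinj : injective h by move=> x y /(congr1 val); apply: finj.
have /(inj_card_bij hinj) [h' hK h'K] : #|induced A| <= #|H|.
  have -> : #|induced A| = #|A| by rewrite card_sub; apply: eq_card.
  by rewrite defA card_imset // cardsT.
exists h'; split; first by exists h.
by move=> x y; rewrite -[x in RHS]h'K -[y in RHS]h'K -fadj.
Qed.

(* A copy of a pattern on 0, ..., k-1 in a relation is listed backwards: the
   entry of the sequence followed by i others plays the role of i. *)
Definition copy_step (V : eqType) (r : rel V) (pat : rel nat) (v : V) (s : seq V) :=
  (v \notin s) && ([seq r v y | y <- s] == [seq pat (size s) i | i <- rev (iota 0 (size s))]).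

Fixpoint copy (V : eqType) (r : rel V) (pat : rel nat) (s : seq V) :=
  if s is v :: s' then copy_step r pat v s' && copy r pat s' else true.

(** Partial copies are discarded as soon as one vertex fails, which keeps the enumeration cheap
    under [vm_compute]. *)
Fixpoint copies (V : eqType) (vs : seq V) (r : rel V) (pat : rel nat) k :=
  if k is k'.+1 then
    [seq v :: s | s <- copies vs r pat k', v <- [seq v <- vs | copy_step r pat v s]]
  else [:: [::]].

Lemma mem_copies (V : eqType) (vs : seq V) r pat k s :
  (s \in copies vs r pat k) = [&& size s == k, all (mem vs) s & copy r pat s].
Proof.
elim: k s => [|k IH] [|v s] //=.
  by apply/allpairsPdep=> -[x [y [_ _]]].
apply/allpairsPdep/idP => [[t [w [tC wC [-> ->]]]] | ].
  move: tC wC; rewrite IH mem_filter => /and3P[/eqP-> -> ->] /andP[-> ->].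
  by rewrite eqxx.
case/and3P=> sz /andP[vvs svs] /andP[vs' cs].
by exists s, v; split; rewrite // ?mem_filter ?vs' // IH -eqSS sz svs.
Qed.

(** Injectivity and adjacency are required only on [s], because one of the maps used later is [nth],
    injective only on valid indices. *)
Lemma copy_map (V W : eqType) (h : V -> W) (rV : rel V) (rW : rel W) pat s :
  {in s &, injective h} -> {in s &, forall x y, rW (h x) (h y) = rV x y} ->
  copy rW pat (map h s) = copy rV pat s.
Proof.
elim: s => //= v s IH hinj hr.
have sS : {subset s <= v :: s} by move=> x; rewrite inE => ->; rewrite orbT.
rewrite IH; [|exact: (sub_in2 sS)..].
rewrite /copy_step size_map -map_comp; congr (_ && _ && _).
  congr (~~ _); apply/mapP/idP=> [[x xs /hinj -> //]|vs]; last by exists v.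
    by rewrite mem_head.
  exact: sS.
congr (_ == _); apply/eq_in_map=> x xs /=; by rewrite hr ?mem_head ?sS.
Qed.

Lemma copy_uniq (V : eqType) (r : rel V) pat s : copy r pat s -> uniq s.
Proof. by elim: s => //= v s IH /andP[/andP[-> _] /IH]. Qed.

Definition edges_pat (s : seq (nat * nat)) : rel nat := fun i j =>
  (i != j) && (((i, j) \in s) || ((j, i) \in s)).

Definition P5_pat := edges_pat [:: (0, 1); (1, 2); (2, 3); (3, 4)].
Definition coP5_pat : rel nat := fun i j => (i != j) && ~~ P5_pat i j.
Definition Bull_pat := edges_pat [:: (0, 1); (1, 2); (2, 3); (1, 4); (2, 4)].

(** The labelling [h] assigns roles to the vertices of [K], which treats [P5], its complement and
    the Bull uniformly. The copy of [pat] in itself is carried along the labelling and the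
    embedding. *)
Lemma copy_pattern (G K : sgraph) (pat : rel nat) (h : K -> 'I_5) (A : {set G}) :
  bijective h -> (forall x y, adj x y = pat (h x) (h y)) ->
  copy pat pat (rev (iota 0 5)) ->
  isomorphic (induced A) K <->
  exists s, [/\ size s = 5, copy (@adj G) pat s & A = [set x in s]].
Proof.
move=> hbij hadj cpat; have [g hK gK] := hbij.
split=> [/isomorphic_inducedP[f [finj fadj ->]] | [s [sz cs ->]]].
  have eqs : map (val \o h) (map g (rev (enum 'I_5))) = rev (iota 0 5).
    by rewrite -map_comp -val_enum_ord -map_rev; apply: eq_map => i /=; rewrite gK.
  exists (map f (map g (rev (enum 'I_5)))); split.
  - by rewrite !size_map size_rev size_enum_ord.
  - rewrite (@copy_map _ _ f (@adj K)); first last.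
    + by move=> x y _ _; apply: fadj.
    + by move=> x y _ _; apply: finj.
    move: cpat; rewrite -eqs (@copy_map _ _ _ (@adj K)) //.
    by move=> x y _ _ /val_inj/(can_inj hK).
  apply/setP=> x; rewrite inE; apply/imsetP/mapP=> -[y yP ->]; exists y => //.
  by rewrite -[y]hK map_f // mem_rev mem_enum.
have us := copy_uniq cs.
case: s sz cs us => [|v4 [|v3 [|v2 [|v1 [|v0 [|]]]]]] // _ cs us.
(* Copies are listed backwards; reversing puts role i at position i. *)
pose l := [:: v0; v1; v2; v3; v4].
have ul : uniq l by rewrite -rev_uniq.
pose f x := nth v0 l (h x).
apply/isomorphic_inducedP; exists f; split.
- move=> x y /eqP; rewrite nth_uniq // => /eqP/val_inj; exact: (can_inj hK).
(* A copy records only the pairs with i < j; symmetry and irreflexivity of [K] settle the others. *)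
- have {}cpat i j : i < j -> j < 5 -> adj (nth v0 l j) (nth v0 l i) = pat j i.
    move: cs; rewrite /= /copy_step /= => /and5P[/andP[_ /eqP[? ? ? ?]]].
    move=> /andP[_ /eqP[? ? ?]] /andP[_ /eqP[? ?]] /andP[_ /eqP[?]] _.
    by case: j i => [|[|[|[|[|j]]]]] [|[|[|[|i]]]].
  have hsym x y : pat (h x) (h y) = pat (h y) (h x) by rewrite -!hadj adj_sym.
  move=> x y; rewrite /f hadj; case: (ltngtP (h x) (h y)) => [lt|lt|/val_inj eq].
  + by rewrite adj_sym cpat ?ltn_ord // hsym.
  + by rewrite cpat ?ltn_ord.
  + by rewrite eq adj_irr -hadj adj_irr.
apply/setP=> x; rewrite inE -mem_rev; apply/idP/imsetP=> [xl|[y _ ->]].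
  have xl5 : index x l < 5 by rewrite -[5]/(size l) index_mem.
  by exists (g (Ordinal xl5)); rewrite // /f gK nth_index.
by rewrite mem_nth.
Qed.

(** * Sparseness decided by computing on sequences and adjacency tables *)

Definition special (V : eqType) (r : rel V) (s : seq V) :=
  (size s == 5) && [|| copy r P5_pat s, copy r coP5_pat s | copy r Bull_pat s].

Lemma special_setP (G : sgraph) (A : {set G}) :
  P5_coP5_Bull_set A <-> exists2 s, special (@adj G) s & A = [set x in s].
Proof.
have bij5 : bijective (id : 'I_5 -> 'I_5) by exists id.
have P5P := @copy_pattern G P5 P5_pat id A bij5 (fun _ _ => erefl) isT.
have coP5P := @copy_pattern G (compl P5) coP5_pat id A bij5 (fun _ _ => erefl) isT.
have BullP := @copy_pattern G Bull Bull_pat id A bij5 (fun _ _ => erefl) isT.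
split=> [[_ H]|[s /andP[/eqP sz H] defA]].
  by case: H => [/P5P|[/coP5P|/BullP]] [s [sz cs defA]]; exists s => //;
    rewrite /special sz cs ?orbT.
have us : uniq s by case/or3P: H => /copy_uniq.
split; first by rewrite defA cardsE -sz; apply/card_uniqP.
case/or3P: H => H; [left; apply/P5P|right; left; apply/coP5P|right; right; apply/BullP];
  by exists s.
Qed.

(** The 6-set disappears: two distinct 5-subsets have it as their union, and conversely a union of
    size six is such a 6-set. *)
Lemma sparseP (G : sgraph) :
  P5_coP5_Bull_sparse G <->
  forall s1 s2, special (@adj G) s1 -> special (@adj G) s2 ->
    size (undup (s1 ++ s2)) != 6.
Proof.
have szE (s1 s2 : seq G) : size (undup (s1 ++ s2)) = #|[set x in s1] :|: [set x in s2]|.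
  rewrite -(card_uniqP (undup_uniq _)); apply: eq_card => x.
  by rewrite mem_undup mem_cat !inE.
split=> [sp s1 s2 sp1 sp2 | sp S cS A B AS BS].
  rewrite szE; apply/eqP => c6.
  have c5 s : special (@adj G) s -> #|[set x in s]| = 5.
    by move=> ss; have [] : P5_coP5_Bull_set [set x in s] by apply/special_setP; exists s.
  have eq12 : [set x in s1] = [set x in s2].
    apply: (sp _ c6); rewrite ?subsetUl ?subsetUr //; apply/special_setP;
    by [exists s1|exists s2].
  by move: c6; rewrite eq12 setUid c5.
move=> spA spB; have [cA _] := spA; have [cB _] := spB.
case/special_setP: spA => s1 sp1 defA; case/special_setP: spB => s2 sp2 defB.
have := sp _ _ sp1 sp2; rewrite szE -defA -defB => /eqP c6.
have le6 : #|A :|: B| <= 6 by rewrite -cS subset_leq_card // subUset AS.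
have {}le6 : #|A :|: B| <= 5 by rewrite leq_eqVlt in le6; case/orP: le6 => [/eqP|].
by transitivity (A :|: B); apply/eqP; [|rewrite eq_sym];
  rewrite eqEcard ?subsetUl ?subsetUr ?cA ?cB.
Qed.

Lemma special_map (V W : eqType) (h : V -> W) (rV : rel V) (rW : rel W) s :
  {in s &, injective h} -> {in s &, forall x y, rW (h x) (h y) = rV x y} ->
  special rW (map h s) = special rV s.
Proof. by move=> hinj hr; rewrite /special size_map !(copy_map _ hinj hr). Qed.

Lemma sparse_embedding (G H : sgraph) (f : G -> H) :
  injective f -> (forall x y, adj (f x) (f y) = adj x y) ->
  P5_coP5_Bull_sparse H -> P5_coP5_Bull_sparse G.
Proof.
move=> finj fadj /sparseP sp; apply/sparseP=> s1 s2 sp1 sp2.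
have spf s : special (@adj G) s -> special (@adj H) (map f s).
  by rewrite (@special_map _ _ f (@adj G)) // => x y _ _; apply: finj.
have := sp _ _ (spf _ sp1) (spf _ sp2).
by rewrite -map_cat undup_map_inj // size_map.
Qed.

(* Two special 5-sets lie in a common 6-set exactly when they are equal or their
   union has 6 elements, see [sparseP]. *)
Definition clash (n : nat) (r : rel nat) :=
  let sp := copies (iota 0 n) r P5_pat 5 ++ copies (iota 0 n) r coP5_pat 5
            ++ copies (iota 0 n) r Bull_pat 5 in
  has (fun s1 => has (fun s2 => size (undup (s1 ++ s2)) == 6) sp) sp.

Arguments clash : simpl never.

Lemma clashP (n : nat) (r : rel nat) :
  reflect (exists s1 s2, [/\ all (mem (iota 0 n)) s1, all (mem (iota 0 n)) s2,
      special r s1, special r s2 & size (undup (s1 ++ s2)) = 6]) (clash n r).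
Proof.
apply: (iffP hasP) => [[s1 s1P /hasP[s2 s2P /eqP sz]]|[s1 [s2 [a1 a2 sp1 sp2 sz]]]].
  exists s1, s2; move: s1P s2P; rewrite /special !mem_cat !mem_copies.
  by do 2!case/or3P => /and3P[-> -> ->]; rewrite ?orbT.
exists s1; last (apply/hasP; exists s2; last exact/eqP).
  by rewrite !mem_cat !mem_copies a1 -!andb_orr.
by rewrite !mem_cat !mem_copies a2 -!andb_orr.
Qed.

Lemma inj_surj_bij (T U : finType) (f : T -> U) :
  injective f -> (forall y, exists x, f x = y) -> bijective f.
Proof.
move=> finj fsurj; have ex y : exists x, f x == y by have [x /eqP] := fsurj y; exists x.
pose g y := xchoose (ex y); have gK y : f (g y) = y by apply/eqP/(xchooseP (ex y)).
by exists g => // x; apply: finj.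
Qed.

(** Lower triangle of the adjacency matrix, each vertex against the earlier ones collected in [acc].
    Every unordered pair is thus a single boolean, open to rewriting and case analysis. *)
Fixpoint lower_rows (G : sgraph) (acc vs : seq G) : seq (seq bool) :=
  if vs is v :: vs' then [seq adj y v | y <- acc] :: lower_rows (rcons acc v) vs'
  else [::].

Definition matrix_rel (m : seq (seq bool)) : rel nat := fun i j =>
  if i < j then nth false (nth [::] m j) i
  else if j < i then nth false (nth [::] m i) j else false.

Definition adj_table (G : sgraph) (vs : seq G) := matrix_rel (lower_rows [::] vs).

Lemma nth_lower_rows (G : sgraph) (x0 : G) acc vs j : j < size vs ->
  nth [::] (lower_rows acc vs) j = [seq adj y (nth x0 vs j) | y <- acc ++ take j vs].
Proof.
elim: vs acc j => [|v vs IH] acc [|j] //= lt; first by rewrite cats0.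
by rewrite IH // cat_rcons.
Qed.

Lemma adj_tableE (G : sgraph) (x0 : G) vs i j : i < size vs -> j < size vs ->
  adj (nth x0 vs i) (nth x0 vs j) = adj_table vs i j.
Proof.
move=> ilt jlt; rewrite /adj_table /matrix_rel.
have aux k l : l < size vs -> k < l ->
    adj (nth x0 vs k) (nth x0 vs l) = nth false (nth [::] (lower_rows [::] vs) l) k.
  move=> llt kl; rewrite (nth_lower_rows x0) // cat0s (nth_map x0) ?nth_take //.
  by rewrite size_take llt.
case: ltngtP => [|lt|->]; [exact: aux | by rewrite adj_sym aux | exact: adj_irr].
Qed.

(** Bridge from evaluation to [G]: a clash among indices is carried by [nth] to two special
    sequences of vertices whose union has six elements. *)
Lemma table_not_clash (G : sgraph) (vs : seq G) :
  P5_coP5_Bull_sparse G -> uniq vs ->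
  ~~ clash (size vs) (adj_table vs).
Proof.
case: vs => // x0 vs' /sparseP sp; set vs := x0 :: vs' => uvs; apply/clashP.
case=> s1 [s2 [a1 a2 sp1 sp2 sz]].
have lt_s s i : all (mem (iota 0 (size vs))) s -> i \in s -> i < size vs.
  by move=> /allP h /h; rewrite inE mem_iota.
have hinj s : all (mem (iota 0 (size vs))) s -> {in s &, injective (nth x0 vs)}.
  move=> h i j /(lt_s _ _ h) ilt /(lt_s _ _ h) jlt /eqP.
  by rewrite nth_uniq // => /eqP.
have spm s : all (mem (iota 0 (size vs))) s -> special (adj_table vs) s ->
    special (@adj G) (map (nth x0 vs) s).
  move=> h; rewrite (special_map (hinj _ h) (rV := adj_table vs)) //.
  by move=> i j /(lt_s _ _ h) ilt /(lt_s _ _ h) jlt; apply: adj_tableE.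
have /eqP[] := sp _ _ (spm _ a1 sp1) (spm _ a2 sp2).
have a12 : all (mem (iota 0 (size vs))) (undup (s1 ++ s2)).
  by rewrite all_undup all_cat a1.
(* Since [nth] is injective on valid indices, removing duplicates before or after it leaves equally
   many entries. *)
rewrite -map_cat -sz -(size_map (nth x0 vs) (undup _)); apply: perm_size.
apply: uniq_perm; rewrite ?undup_uniq ?map_inj_in_uniq ?undup_uniq //.
  exact: hinj.
by move=> y; rewrite mem_undup; apply: eq_mem_map => i; rewrite mem_undup.
Qed.

Lemma edges_iso (G : sgraph) (x0 : G) (vs : seq G) E :
  uniq vs -> (forall x, x \in vs) ->
  all (fun i => all (fun j => adj_table vs i j == edges_pat E i j) (iota 0 (size vs)))
      (iota 0 (size vs)) ->
  isomorphic G (graph_of_edges (size vs) E).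
Proof.
move=> uvs vsT /allP adjE; apply: isomorphic_sym.
exists (fun i : 'I_(size vs) => nth x0 vs i); split.
  apply: inj_surj_bij => [i j /eqP|x]; first by rewrite nth_uniq // => /eqP/val_inj.
  have lt : index x vs < size vs by rewrite index_mem.
  by exists (Ordinal lt); apply: nth_index.
move=> i j; rewrite adj_tableE //.
have/adjE/allP iP : (i : nat) \in iota 0 (size vs) by rewrite mem_iota ltn_ord.
by apply/eqP/iP; rewrite mem_iota ltn_ord.
Qed.

Lemma sparse_edges n E : ~~ clash n (edges_pat E) -> P5_coP5_Bull_sparse (graph_of_edges n E).
Proof.
move=> nc; apply/sparseP=> s1 s2 sp1 sp2; apply: contraNneq nc => sz.
have valP s : special (@adj (graph_of_edges n E)) s -> special (edges_pat E) (map val s).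
  rewrite (@special_map _ _ val (@adj (graph_of_edges n E))) // => i j _ _; exact: val_inj.
have valT (s : seq 'I_n) : all (mem (iota 0 n)) (map val s).
  by apply/allP=> _ /mapP[i _ ->]; rewrite inE mem_iota ltn_ord.
apply/clashP; exists (map val s1), (map val s2); split; [exact: valT..|exact: valP|exact: valP|].
by rewrite -map_cat undup_map_inj ?size_map //; apply: val_inj.
Qed.

(** * Graphs of the two types are sparse *)

Lemma second_graph_sparse opt : P5_coP5_Bull_sparse (second_graph opt).
Proof. by apply: sparse_edges; case: opt; vm_compute. Qed.

Section BundleSparse.
Variables (k : nat) (opt : bool).
Local Notation B := (P5_bundle k opt).
Local Notation x := (inl (inl tt) : B).
Local Notation u i := (inr (inl i) : B).
Local Notation v i := (inr (inr i) : B).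

Definition mate (q : B) : B :=
  match q with inr (inl i) => v i | inr (inr i) => u i | _ => q end.

(** The complement of [P5] and the Bull both contain a triangle, so this leaves [P5] as the only
    special graph in a bundle. *)
Lemma bundle_triangle_free (p q r : B) : adj p q -> adj q r -> adj p r = false.
Proof. by case: p => [[[]|?]|[?|?]]; case: q => [[[]|?]|[?|?]]; case: r => [[[]|?]|[?|?]]. Qed.

Lemma bundle_nbrs (p q : B) : adj p q ->
  match p with
  | inl (inl _) => (exists i, q = u i) \/ (exists j, q = inl (inr j))
  | inl (inr _) => q = x
  | inr (inl i) => q = x \/ q = v i
  | inr (inr i) => q = u i
  end.
Proof.
case: p => [[[]|j]|[i|i]]; case: q => [[[]|j']|[i'|i']] //=; rewrite ?/bundle_adj /=.
- by right; exists j'.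
- by left; exists i'.
- by left.
- by move/eqP->; right.
- by move/eqP->.
Qed.

(** The middle of an induced path needs two neighbours, each with a further neighbour. This excludes
    the leaves, and also [u i], whose neighbour [v i] is a leaf; only [x] remains, and the leaf [y]
    cannot continue a path from it. *)
Lemma special_bundle (s : seq B) :
  special (@adj B) s -> exists i j, s = [:: v j; u j; x; u i; v i].
Proof.
case/andP; case: s => [|v4 [|v3 [|v2 [|v1 [|v0 [|]]]]]] // _.
rewrite /= /copy_step /=; case/or3P; last first.
(* Triangles: roles 1, 2, 4 in the Bull, then roles 0, 2, 4 in the complement of [P5]. *)
- case/and5P=> /andP[_ /eqP[_ a42 a41 _]] _ /andP[_ /eqP[a21 _]] _ _.
  by have := bundle_triangle_free a42 a21; rewrite /= a41.
- case/and5P=> /andP[_ /eqP[_ a42 _ a40]] _ /andP[_ /eqP[_ a20]] _ _.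
  by have := bundle_triangle_free a42 a20; rewrite /= a40.
case/and5P=> /andP[n4 /eqP[a43 _ _ _]] /andP[n3 /eqP[a32 _ _]] /andP[n2 /eqP[a21 _]].
move=> /andP[n1 /eqP[a10]] _.
move: n4 n3 n2 n1; rewrite !inE !negb_or.
move=> /and4P[_ /eqP n42 _ _] /and3P[_ /eqP n31 _] /andP[_ /eqP n20] _.
have a23 : adj v2 v3 by rewrite adj_sym.
have a34 : adj v3 v4 by rewrite adj_sym.
case: v2 {a32} a23 a21 n42 n20 => [[[]|l]|[l|l]] a23 a21 n42 n20.
- have [i ? ?] : exists2 i, v1 = u i & v0 = v i.
    case: (bundle_nbrs a21) => [] [i e1]; subst v1; have := bundle_nbrs a10.
      by case=> e0; [case: n20 | exists i].
    by move=> /esym/n20.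
  have [j ? ?] : exists2 j, v3 = u j & v4 = v j.
    case: (bundle_nbrs a23) => [] [j e3]; subst v3; have := bundle_nbrs a34.
      by case=> e4; [case: n42 | exists j].
    by move=> /n42.
  by subst; exists i, j.
- by case: n31; rewrite (bundle_nbrs a21) (bundle_nbrs a23).
- case: (bundle_nbrs a21) (bundle_nbrs a23) => e1 [] e3; subst v1 v3 => //.
  + by case: n42; apply: (bundle_nbrs a34).
  + by case: n20; rewrite (bundle_nbrs a10).
- by case: n31; rewrite (bundle_nbrs a21) (bundle_nbrs a23).
Qed.

Lemma special_mate (s : seq B) q :
  special (@adj B) s -> q \in s -> q = x \/ mate q \in s /\ mate q != q.
Proof.
case/special_bundle=> i [j ->]; rewrite !inE.
by case/or4P=> [/eqP->|/eqP->|/eqP->|/orP[]/eqP->]; [right..|left|right|right];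
  rewrite /= ?eqxx ?orbT.
Qed.

(** Apart from [x], special sets consist of whole pairs of mates. A vertex of one set outside the
    other therefore brings its mate along, and the union has at least 5 + 2 elements. *)
Lemma bundle_sparse : P5_coP5_Bull_sparse B.
Proof.
apply/sparseP=> s1 s2 sp1 sp2; apply/negP=> /eqP sz.
have s2x : x \in s2 by have [i [j ->]] := special_bundle sp2; rewrite !inE eqxx ?orbT.
have us2 : uniq s2 by case/andP: sp2 => _ /or3P[] /copy_uniq.
have /eqP sz2 : size s2 == 5 by case/andP: sp2.
have [sub12|] := boolP (all (mem s2) s1).
  suff : size (undup (s1 ++ s2)) <= size s2 by rewrite sz sz2.
  apply: uniq_leq_size (undup_uniq _) _ => q; rewrite mem_undup mem_cat.
  by case/orP=> // /(allP sub12).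
case/allPn=> q q1 q2; have [qx|[m1 mq]] := special_mate sp1 q1.
  by case/negP: q2; rewrite qx; exact: s2x.
have m2 : mate q \notin s2.
  apply: contra q2 => m2; have [mx|[]] := special_mate sp2 m2.
    by move: mq mx; case: (q) => [[[]|?]|[?|?]].
  by case: (q) => [[[]|?]|[?|?]].
suff : 7 <= size (undup (s1 ++ s2)) by rewrite sz.
rewrite -[7]/(5.+2) -sz2 -[_.+2]/(size [:: mate q, q & s2]).
apply: uniq_leq_size => [|r]; first by rewrite /= inE negb_or mq m2 q2.
rewrite mem_undup mem_cat !inE => /or3P[/eqP->|/eqP->|->]; rewrite ?m1 ?q1 ?orbT //.
Qed.
End BundleSparse.

Lemma of_two_types_sparse (G : sgraph) : of_two_types G -> P5_coP5_Bull_sparse G.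
Proof.
case=> [[k [opt [_ [f [fbij fadj]]]]]|[opt [f [fbij fadj]]]];
  apply: (sparse_embedding (bij_inj fbij) fadj).
- exact: bundle_sparse.
- exact: second_graph_sparse.
Qed.

(** * Recognising a bundle *)

(** Here [c] plays x, the members of [W] are the v's, [p] sends each to its u, and [Y] holds the
    optional y. *)
Lemma isomorphic_bundle (G : sgraph) (c : G) (p : G -> G) :
  let W := [set n | (n != c) && ~~ adj c n] in
  let Y := [set y | adj c y & y \notin p @: W] in
  (forall w w', adj c w -> adj c w' -> ~~ adj w w') ->
  (forall n, n \in W -> adj c (p n) /\ forall z, adj n z = (z == p n)) ->
  {in W &, injective p} ->
  #|Y| <= 1 ->
  exists opt, isomorphic G (P5_bundle #|W| opt).
Proof.
move=> W Y indep pP pinj Y1.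
have [opt optP] : exists opt : bool, #|Y| = opt.
  by case: #|Y| Y1 => [|[]] // _; [exists false | exists true].
exists opt; apply: isomorphic_sym.
have Wc (i : 'I_#|W|) : adj c (enum_val i) = false.
  by have := enum_valP i; rewrite inE => /andP[_ /negbTE].
have Wp (i : 'I_#|W|) := pP _ (enum_valP i).
pose y (j : 'I_opt) : G := enum_val (cast_ord (esym optP) j).
have yP j : adj c (y j) /\ y j \notin p @: W.
  by have := enum_valP (cast_ord (esym optP) j); rewrite inE => /andP.
pose f (q : P5_bundle #|W| opt) : G := match q with
  | inl (inl _) => c
  | inl (inr j) => y j
  | inr (inl i) => p (enum_val i)
  | inr (inr i) => enum_val i
  end.
have pW (i : 'I_#|W|) : p (enum_val i) \in p @: W by apply: imset_f; apply: enum_valP.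
have fadj q r : adj (f q) (f r) = adj q r.
  have yN j : adj (y j) c by rewrite adj_sym; case: (yP j).
  have pN (i : 'I_#|W|) : adj (p (enum_val i)) c by rewrite adj_sym; case: (Wp i).
  have nP (i j : 'I_#|W|) : adj (enum_val i) (p (enum_val j)) = (i == j).
    rewrite (Wp i).2 -(inj_eq enum_val_inj) eq_sym; apply/eqP/eqP => [|->//].
    by move=> e; apply: pinj e; apply: enum_valP.
  have nY (i : 'I_#|W|) j : adj (enum_val i) (y j) = false.
    rewrite (Wp i).2; apply/eqP=> e; have [_] := yP j; by rewrite e pW.
  case: q => [[[]|j]|[i|i]]; case: r => [[[]|j']|[i'|i']]; rewrite /= /bundle_adj /=.
  - exact: adj_irr.
  - by case: (yP j').
  - by case: (Wp i').
  - exact: Wc.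
  - exact: yN.
  - by apply/negbTE/indep; [case: (yP j)|case: (yP j')].
  - by apply/negbTE/indep; [case: (yP j)|case: (Wp i')].
  - by rewrite adj_sym nY.
  - exact: pN.
  - by apply/negbTE/indep; [case: (Wp i)|case: (yP j')].
  - by apply/negbTE/indep; [case: (Wp i)|case: (Wp i')].
  - by rewrite adj_sym nP eq_sym.
  - by rewrite adj_sym Wc.
  - exact: nY.
  - by rewrite nP eq_sym.
  - rewrite (Wp i).2; apply/eqP=> e; have := (Wp i).1; by rewrite -e Wc.
exists f; split=> //; apply: inj_surj_bij.
  have cy j : adj c (y j) by case: (yP j).
  have cp (i : 'I_#|W|) : adj c (p (enum_val i)) by case: (Wp i).
  have cW (i : 'I_#|W|) : enum_val i <> c.
    by have := enum_valP i; rewrite inE => /andP[/eqP].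
  have yp j (i : 'I_#|W|) : y j <> p (enum_val i).
    by move=> e; have [_] := yP j; rewrite e pW.
  (* Adjacency to [c] separates the v's and [c] itself from the u's and y, which removes most pairs
     of roles. *)
  move=> q r e; have := congr1 (adj c) e; move: e.
  case: q => [[[]|j]|[i|i]]; case: r => [[[]|j']|[i'|i']] //=;
    rewrite ?adj_irr ?cy ?cp ?Wc //.
  - by move/esym/cW.
  - by move/enum_val_inj/cast_ord_inj->.
  - by move/yp.
  - by move/esym/yp.
  - by move=> e _; congr (inr (inl _)); apply/enum_val_inj/pinj; rewrite ?enum_valP.
  - by move/cW.
  - by move/enum_val_inj->.
move=> z; have [->|zc] := eqVneq z c; first by exists (inl (inl tt)).
have [cz|cz] := boolP (adj c z); last first.
  have zW : z \in W by rewrite inE zc.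
  by exists (inr (inr (enum_rank_in zW z))); rewrite /= enum_rankK_in.
have [/imsetP[n nW ->]|zY] := boolP (z \in p @: W).
  by exists (inr (inl (enum_rank_in nW n))); rewrite /= enum_rankK_in.
have {}zY : z \in Y by rewrite inE cz.
by exists (inl (inr (cast_ord optP (enum_rank_in zY z)))); rewrite /= /y cast_ordK enum_rankK_in.
Qed.

(** * Complementation *)

Lemma isomorphic_compl (G H : sgraph) : isomorphic G H -> isomorphic (compl G) (compl H).
Proof.
case=> f [fbij fadj]; exists f; split=> // x y.
by rewrite /= /compl_adj fadj (inj_eq (bij_inj fbij)).
Qed.

Lemma compl_complE (G : sgraph) (x y : G) : @adj (compl (compl G)) x y = adj x y.
Proof.
rewrite /= /compl_adj negb_and negbK; case: eqVneq => [->|_] /=; last by rewrite negbK.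
by rewrite adj_irr.
Qed.

Lemma isomorphic_compl_compl (G : sgraph) : isomorphic (compl (compl G)) G.
Proof. by exists id; split=> [|x y]; [exists id | rewrite compl_complE]. Qed.

Lemma isomorphic_induced_compl (G : sgraph) (A : {set G}) :
  isomorphic (compl (induced A)) (@induced (compl G) A).
Proof. by exists id; split; [exists id | move=> x y]. Qed.

Lemma compl_Bull : isomorphic (compl Bull) Bull.
Proof.
pose o i lt : compl Bull := @Ordinal 5 i lt.
(* In the complement, 2-0-3-1 is a path whose middle edge 03 forms a triangle with 4. *)
apply: (@edges_iso _ (o 0 isT) [:: o 2 isT; o 0 isT; o 3 isT; o 1 isT; o 4 isT]).
- by [].
- by case=> [[|[|[|[|[|]]]]]].
- by vm_compute.
Qed.

Lemma isomorphic_induced_complW (G H : sgraph) (A : {set G}) :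
  isomorphic (@induced (compl G) A) H -> isomorphic (induced A) (compl H).
Proof.
move/(isomorphic_trans (isomorphic_induced_compl A))/isomorphic_compl.
by apply: isomorphic_trans; apply/isomorphic_sym/isomorphic_compl_compl.
Qed.

(** Complementation permutes [P5], its complement and the Bull up to isomorphism, so the same 5-sets
    count in both graphs. *)
Lemma sparse_compl (G : sgraph) : P5_coP5_Bull_sparse G -> P5_coP5_Bull_sparse (compl G).
Proof.
have setC A : @P5_coP5_Bull_set (compl G) A -> @P5_coP5_Bull_set G A.
  case=> cA H; split=> //; case: H => [|[]] /isomorphic_induced_complW iso.
  - by right; left.
  - by left; apply: isomorphic_trans iso (isomorphic_compl_compl _).
  - by do 2!right; apply: isomorphic_trans iso compl_Bull.
by move=> sp S cS A B AS BS /setC sA /setC sB; apply: (sp S).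
Qed.

Lemma sparse_complI (G : sgraph) : P5_coP5_Bull_sparse (compl G) -> P5_coP5_Bull_sparse G.
Proof.
move/sparse_compl; apply: (@sparse_embedding G (compl (compl G)) id) => // x y.
exact: compl_complE.
Qed.

Lemma prime_compl (G : sgraph) : prime_graph G -> prime_graph (compl G).
Proof.
move=> pG M modM; apply: pG => z zM.
case: (modM z zM) => /= H; [right|left] => m mM; have := H m mM; rewrite /compl_adj.
  by case/andP.
by case: eqP zM => [->|_ _]; rewrite ?mM //= negbK.
Qed.

(** * Local structure around a fixed induced [P5] *)

Lemma contains_P5P (G : sgraph) : contains_induced G P5 ->
  exists a b c d e : G, uniq [:: a; b; c; d; e] /\
    lower_rows [::] [:: a; b; c; d; e] =
      [:: [::]; [:: true]; [:: false; true]; [:: false; false; true];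
          [:: false; false; false; true]].
Proof.
case=> A /isomorphic_inducedP[f [finj fadj _]].
pose o i lt : P5 := @Ordinal 5 i lt.
exists (f (o 0 isT)), (f (o 1 isT)), (f (o 2 isT)), (f (o 3 isT)), (f (o 4 isT)); split.
  by rewrite /= !inE !(inj_eq finj).
by rewrite /= !fadj.
Qed.

Lemma lower_rows_cat (G : sgraph) (acc s1 s2 : seq G) :
  lower_rows acc (s1 ++ s2) = lower_rows acc s1 ++ lower_rows (acc ++ s1) s2.
Proof.
by elim: s1 acc => [|v s1 IH] acc /=; rewrite ?cats0 // IH cat_rcons.
Qed.

Section PrimeSparse.
Variable G : sgraph.
Hypothesis Gprime : prime_graph G.
Hypothesis Gsparse : P5_coP5_Bull_sparse G.
Variables a b c d e : G.
Local Notation P := [:: a; b; c; d; e].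
Hypothesis uniqP : uniq P.

Definition P5_rows :=
  [:: [::]; [:: true]; [:: false; true]; [:: false; false; true];
      [:: false; false; false; true]].
Hypothesis rowsP : lower_rows [::] P = P5_rows.

Definition trace z := [seq adj y z | y <- P].
Definition is_anti z := trace z == nseq 5 false.
Definition is_pend z := trace z == [:: false; false; true; false; false].
Definition is_full z := (z \notin P) && (trace z == nseq 5 true).

Lemma P_adj :
  (adj a b = true) * (adj a c = false) * (adj a d = false) * (adj a e = false) *
  (adj b c = true) * (adj b d = false) * (adj b e = false) *
  (adj c d = true) * (adj c e = false) * (adj d e = true) *
  (adj b a = true) * (adj c a = false) * (adj d a = false) * (adj e a = false) *
  (adj c b = true) * (adj d b = false) * (adj e b = false) *
  (adj d c = true) * (adj e c = false) * (adj e d = true).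
Proof.
case: rowsP => ab ac bc ad bd cd ae be ce de.
rewrite (adj_sym b a) (adj_sym c a) (adj_sym d a) (adj_sym e a) (adj_sym c b).
rewrite (adj_sym d b) (adj_sym e b) (adj_sym d c) (adj_sym e c) (adj_sym e d).
by rewrite ab ac ad ae bc bd be cd ce de.
Qed.

Lemma anti_adj z : is_anti z ->
  (adj a z = false) * (adj b z = false) * (adj c z = false) * (adj d z = false) *
  (adj e z = false) * (adj z a = false) * (adj z b = false) * (adj z c = false) *
  (adj z d = false) * (adj z e = false).
Proof. by rewrite !(adj_sym z) => /eqP[-> -> -> -> ->]. Qed.

Lemma pend_adj z : is_pend z ->
  (adj a z = false) * (adj b z = false) * (adj c z = true) * (adj d z = false) *
  (adj e z = false) * (adj z a = false) * (adj z b = false) * (adj z c = true) *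
  (adj z d = false) * (adj z e = false).
Proof. by rewrite !(adj_sym z) => /eqP[-> -> -> -> ->]. Qed.

Lemma full_adj z : is_full z ->
  (adj a z = true) * (adj b z = true) * (adj c z = true) * (adj d z = true) *
  (adj e z = true) * (adj z a = true) * (adj z b = true) * (adj z c = true) *
  (adj z d = true) * (adj z e = true).
Proof. by rewrite !(adj_sym z) => /andP[_ /eqP[-> -> -> -> ->]]. Qed.

Lemma in_P z : z \in P -> [\/ z = a, z = b, z = c | z = d \/ z = e].
Proof.
rewrite !inE => /or4P[/eqP->|/eqP->|/eqP->|/orP[]/eqP->];
  by [constructor 1|constructor 2|constructor 3|constructor 4; left|constructor 4; right].
Qed.

Lemma anti_notP z : is_anti z -> z \notin P.
Proof.
move=> /anti_adj nz; apply/negP=> /in_P[eq|eq|eq|[]eq]; subst z;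
  by move: nz; rewrite !P_adj => nz; case: nz => [[[[[[[[[]]]]]]]]].
Qed.

Lemma pend_notP z : is_pend z -> z \notin P.
Proof.
move=> /pend_adj nz; apply/negP=> /in_P[eq|eq|eq|[]eq]; subst z;
  by move: nz; rewrite !P_adj ?adj_irr => nz; case: nz => [[[[[[[[[]]]]]]]]].
Qed.

Lemma full_notP z : is_full z -> z \notin P.
Proof. by case/andP. Qed.

(** Source of all the local facts below: once the entries of the table are concrete booleans,
    [vm_compute] detects the clashes. As [clash] is [simpl never], [/=] fills in the table without
    unfolding the search. *)
Lemma config zs : uniq (P ++ zs) ->
  ~~ clash (5 + size zs) (matrix_rel (P5_rows ++ lower_rows P zs)).
Proof.
move/(table_not_clash Gsparse); rewrite size_cat /adj_table lower_rows_cat.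
by rewrite rowsP.
Qed.

(** Each of the other 29 traces produces a second special set within the six vertices. *)
Lemma type_cases z : z \notin P -> [|| is_anti z, is_pend z | is_full z].
Proof.
move=> zP; have uz : uniq (P ++ [:: z]).
  by rewrite cat_uniq uniqP -all_predC all_seq1 /= andbT; exact: zP.
have := config uz; rewrite /is_full zP /is_anti /is_pend /trace /=.
by case: (adj a z); case: (adj b z); case: (adj c z); case: (adj d z); case: (adj e z);
   vm_compute.
Qed.

Definition typed z := [|| is_anti z, is_pend z | is_full z].

Lemma uniq_typed zs : uniq zs -> all typed zs -> uniq (P ++ zs).
Proof.
move=> u h; rewrite cat_uniq uniqP u andbT -all_predC; apply: sub_all h => z.
by case/or3P=> [/anti_notP|/pend_notP|/full_notP].
Qed.

Lemma anti_pend z z' : is_anti z -> is_pend z' -> (z != z') * (z' != z).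
Proof.
move=> Nz Xz; suff ne : z != z' by split; rewrite // eq_sym.
by apply: contraTneq Xz => <-; rewrite /is_pend (eqP Nz).
Qed.

Lemma anti_full z z' : is_anti z -> is_full z' -> (z != z') * (z' != z).
Proof.
move=> Nz Tz; suff ne : z != z' by split; rewrite // eq_sym.
by apply: contraTneq Tz => <-; rewrite /is_full (eqP Nz) andbF.
Qed.

Lemma pend_full z z' : is_pend z -> is_full z' -> (z != z') * (z' != z).
Proof.
move=> Xz Tz; suff ne : z != z' by split; rewrite // eq_sym.
by apply: contraTneq Tz => <-; rewrite /is_full (eqP Xz) andbF.
Qed.

(** The set a, c, d, x, t induces a Bull. If x' misses t, replacing x by x' gives another; if x'
    sees t but misses x, replacing d by x' does. *)
Lemma pend_pend_full x x' t : is_pend x -> is_pend x' -> is_full t -> x != x' -> ~~ adj x t ->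
  adj x x' && adj x' t.
Proof.
move=> Xx Xx' Tt xx' /negbTE xt.
have uz : uniq (P ++ [:: x; x'; t]).
  apply: uniq_typed; last by rewrite /= /typed Xx Xx' Tt ?orbT.
  by rewrite /= !inE !negb_or xx' !(pend_full Xx Tt) !(pend_full Xx' Tt).
have := config uz; rewrite /= !(pend_adj Xx) !(pend_adj Xx') !(full_adj Tt) xt.
by case: (adj x x'); case: (adj x' t); vm_compute.
Qed.

(** Again a, c, d, x, t induces a Bull. If x misses t', replacing t by t' gives another; if x sees
    t' but t misses it, replacing d by t' gives the complement of [P5]. *)
Lemma pend_full_full x t t' : is_pend x -> is_full t -> is_full t' -> t != t' -> ~~ adj x t ->
  adj x t' && adj t t'.
Proof.
move=> Xx Tt Tt' tt' /negbTE xt.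
have uz : uniq (P ++ [:: x; t; t']).
  apply: uniq_typed; last by rewrite /= /typed Xx Tt Tt' ?orbT.
  by rewrite /= !inE !negb_or tt' !(pend_full Xx Tt) !(pend_full Xx Tt').
have := config uz; rewrite /= !(pend_adj Xx) !(full_adj Tt) !(full_adj Tt') xt.
by case: (adj x t'); case: (adj t t'); vm_compute.
Qed.

(** If n sees x but not t, then a, c, x, n, t induces a [P5] or a Bull next to the path a-b-c-x-n.
    If n sees t but x does not, then n, c, d, x, t induces a Bull or the complement of [P5] next to
    the Bull on a, c, d, x, t. *)
Lemma anti_pend_full n x t : is_anti n -> is_pend x -> is_full t ->
  (adj x n ==> adj n t) && (adj n t ==> adj x t).
Proof.
move=> Nn Xx Tt.
have uz : uniq (P ++ [:: n; x; t]).
  apply: uniq_typed; last by rewrite /= /typed Nn Xx Tt ?orbT.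
  by rewrite /= !inE !negb_or !(anti_pend Nn Xx) !(pend_full Xx Tt) !(anti_full Nn Tt).
have := config uz; rewrite /= (adj_sym x n) !(pend_adj Xx) !(full_adj Tt) !(anti_adj Nn).
by case: (adj n x); case: (adj n t); case: (adj x t); vm_compute.
Qed.

(** The path a-b-c-x-n clashes with a-b-c-x-n' if x sees n', and otherwise with b-c-x-n-n' if n sees
    n'. *)
Lemma anti_anti_pend n n' x : is_anti n -> is_anti n' -> is_pend x -> n != n' -> adj x n ->
  ~~ adj n n' && ~~ adj x n'.
Proof.
move=> Nn Nn' Xx nn' xn.
have uz : uniq (P ++ [:: n; n'; x]).
  apply: uniq_typed; last by rewrite /= /typed Nn Nn' Xx ?orbT.
  by rewrite /= !inE !negb_or nn' !(anti_pend Nn Xx) !(anti_pend Nn' Xx).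
have := config uz.
rewrite /= !(pend_adj Xx) !(anti_adj Nn) !(anti_adj Nn') (adj_sym n x) (adj_sym n' x) xn.
by case: (adj n n'); case: (adj x n'); vm_compute.
Qed.

(** The path a-b-c-x-n clashes with a-b-c-x'-n if x' sees n, and otherwise with the Bull on b, c, x,
    x', n if x sees x'. *)
Lemma anti_pend_pend n x x' : is_anti n -> is_pend x -> is_pend x' -> x != x' -> adj x n ->
  ~~ adj x x' && ~~ adj x' n.
Proof.
move=> Nn Xx Xx' xx' xn.
have uz : uniq (P ++ [:: n; x; x']).
  apply: uniq_typed; last by rewrite /= /typed Nn Xx Xx' ?orbT.
  by rewrite /= !inE !negb_or xx' !(anti_pend Nn Xx) !(anti_pend Nn Xx').
have := config uz.
rewrite /= !(pend_adj Xx) !(pend_adj Xx') !(anti_adj Nn) (adj_sym n x) (adj_sym n x') xn.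
by case: (adj x x'); case: (adj x' n); vm_compute.
Qed.

(** By the previous lemmas x, x', t, t' would form a chordless 4-cycle; adding a or b, each adjacent
    to exactly t and t', yields two copies of the complement of [P5]. *)
Lemma nonadjacent_pairs x x' t t' : is_pend x -> is_pend x' -> is_full t -> is_full t' ->
  x != x' -> t != t' -> adj x t || adj x' t'.
Proof.
move=> Xx Xx' Tt Tt' xx' tt'; apply: contraT; rewrite negb_or => /andP[xt x't'].
have uz : uniq (P ++ [:: x; x'; t; t']).
  apply: uniq_typed; last by rewrite /= /typed Xx Xx' Tt Tt' ?orbT.
  rewrite /= !inE !negb_or xx' tt'.
  by rewrite !(pend_full Xx Tt) !(pend_full Xx Tt') !(pend_full Xx' Tt) !(pend_full Xx' Tt').
have [x_x' x't] := andP (pend_pend_full Xx Xx' Tt xx' xt).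
have [xt' t_t'] := andP (pend_full_full Xx Tt Tt' tt' xt).
have := config uz.
rewrite /= !(pend_adj Xx) !(pend_adj Xx') !(full_adj Tt) !(full_adj Tt').
by rewrite x_x' x't xt' t_t' (negbTE xt) (negbTE x't'); vm_compute.
Qed.

Lemma large_module_full (M : {set G}) x y :
  is_module M -> x \in M -> y \in M -> x != y -> forall z, z \in M.
Proof.
move=> modM xM yM xy z; case: (Gprime modM) => [M0|[[w Mw]|->]]; last by rewrite inE.
  by rewrite M0 inE in xM.
by case/negP: xy; move: xM yM; rewrite Mw !inE => /eqP-> /eqP->.
Qed.

Lemma proper_module_eq (M : {set G}) x y z :
  is_module M -> z \notin M -> x \in M -> y \in M -> x = y.
Proof.
move=> modM zM xM yM; apply/eqP; apply: contraNT zM => xy.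
exact: (large_module_full modM xM yM xy).
Qed.

Lemma P_neq : [/\ a != b, a != e, b != d, a != c & e != c].
Proof.
move: uniqP; rewrite /= !inE !negb_or => /andP[/and4P[ab ac _ ae]].
by case/andP=> /and3P[_ bd _] /andP[/andP[_ ce] _]; split; rewrite // eq_sym.
Qed.

(** * Every pend vertex sees every full vertex: the bundle *)

Section Bundle.
Hypothesis complete_pend_full : forall x t, is_pend x -> is_full t -> adj x t.

(** Excludes full vertices and unmatched anti vertices: outside this module the former would see all
    of it, the latter none of it. *)
Lemma hanging_full z :
  [|| z \in P, is_pend z | is_anti z && [exists x, is_pend x && adj x z]].
Proof.
pose M := [set z | [|| z \in P, is_pend z | is_anti z && [exists x, is_pend x && adj x z]]].
suff : z \in M by rewrite inE.
have aM : a \in M by rewrite in_set mem_head.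
have bM : b \in M by rewrite in_set !inE eqxx orbT.
have [ab _ _ _ _] := P_neq; apply: (large_module_full _ aM bM ab) => {}z.
rewrite in_set => zM.
have zP : z \notin P by apply: contra zM => ->.
have zX : is_pend z = false by apply: contraNF zM => ->; rewrite orbT.
have zN : ~~ (is_anti z && [exists x, is_pend x && adj x z]).
  by apply: contra zM => ->; rewrite !orbT.
case/or3P: (type_cases zP) => [Nz|Xz|Tz]; last 1 first.
- left=> m; rewrite in_set => /or3P[/in_P mP|Xm|/andP[Nm /existsP[x /andP[Xx xm]]]].
  + by case: mP => [->|->|->|[]->]; rewrite (full_adj Tz).
  + by rewrite adj_sym complete_pend_full.
  + by have := anti_pend_full Nm Xx Tz; rewrite xm adj_sym => /andP[].
- right=> m; rewrite in_set => /or3P[/in_P mP|Xm|/andP[Nm /existsP[x /andP[Xx xm]]]].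
  + by case: mP => [->|->|->|[]->]; rewrite (anti_adj Nz).
  + apply: contra zN => zm; rewrite Nz; apply/existsP; exists m.
    by rewrite Xm adj_sym.
  + have mz : m != z.
      apply: contraNneq zN => <-; rewrite Nm; apply/existsP; exists x.
      by rewrite Xx.
    by have := anti_anti_pend Nm Nz Xx mz xm; rewrite adj_sym => /andP[].
- by rewrite Xz in zX.
Qed.

(** The matching from anti to pend, extended by the arms a-b and e-d of the fixed path, which are
    arms of the bundle like any other; [c] is only a default. *)
Definition root n :=
  if n == a then b else if n == e then d else odflt c [pick x | is_pend x && adj x n].

Lemma a_not_anti : ~~ is_anti a.
Proof. by apply/negP=> /anti_notP; rewrite mem_head. Qed.

Lemma e_not_anti : ~~ is_anti e.
Proof. by apply/negP=> /anti_notP; rewrite !inE eqxx !orbT. Qed.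

Lemma rootP n : is_anti n -> is_pend (root n) && adj (root n) n.
Proof.
move=> Nn; rewrite /root; have [na|_] := eqVneq n a.
  by case/negP: a_not_anti; rewrite -na.
have [ne|_] := eqVneq n e; first by case/negP: e_not_anti; rewrite -ne.
case: pickP => [x //|no]; case/or3P: (hanging_full n) => [nP|Xn|/andP[_ /existsP[x]]].
- by case/negP: (anti_notP Nn).
- by have := (anti_pend Nn Xn).1; rewrite eqxx.
- by rewrite no.
Qed.

Lemma root_a : root a = b.
Proof. by rewrite /root eqxx. Qed.

Lemma root_e : root e = d.
Proof.
by rewrite /root eqxx eq_sym; have [_ /negbTE-> _ _ _] := P_neq.
Qed.

Lemma far_cases n : n != c -> ~~ adj c n -> [\/ n = a, n = e | is_anti n].
Proof.
move=> nc cn; case/or3P: (hanging_full n) => [/in_P|Xn|/andP[Nn _]].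
- case=> [->|en|en|[]en]; [exact: Or31|..|exact: Or32].
  + by move: cn; rewrite en P_adj.
  + by rewrite en eqxx in nc.
  + by move: cn; rewrite en P_adj.
- by rewrite (pend_adj Xn) in cn.
- exact: Or33.
Qed.

Lemma near_cases n : adj c n -> [\/ n = b, n = d | is_pend n].
Proof.
move=> cn; case/or3P: (hanging_full n) => [/in_P|Xn|/andP[Nn _]].
- by case=> [en|->|en|[]en]; [|exact: Or31| |exact: Or32|]; move: cn; rewrite en ?P_adj ?adj_irr.
- exact: Or33.
- by rewrite (anti_adj Nn) in cn.
Qed.

Lemma far_nbrs n z : n != c -> ~~ adj c n -> adj n z = (z == root n).
Proof.
move=> nc cn; apply/idP/eqP => [nz | ->]; case: (far_cases nc cn) => [na|ne|Nn].
- subst n; rewrite root_a; case/or3P: (hanging_full z) => [/in_P zP|Xz|/andP[Nz _]].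
  + by case: zP nz => [->|->|->|[]->]; rewrite ?P_adj ?adj_irr.
  + by rewrite (pend_adj Xz) in nz.
  + by rewrite (anti_adj Nz) in nz.
- subst n; rewrite root_e; case/or3P: (hanging_full z) => [/in_P zP|Xz|/andP[Nz _]].
  + by case: zP nz => [->|->|->|[]->]; rewrite ?P_adj ?adj_irr.
  + by rewrite (pend_adj Xz) in nz.
  + by rewrite (anti_adj Nz) in nz.
- have /andP[Xr rn] := rootP Nn.
  case/or3P: (hanging_full z) => [/in_P zP|Xz|/andP[Nz _]].
  + by case: zP nz => [->|->|->|[]->]; rewrite (anti_adj Nn).
  + apply/eqP; apply: contraLR nz; rewrite eq_sym => rz; rewrite adj_sym.
    by have /andP[] := anti_pend_pend Nn Xr Xz rz rn.
  + have nz' : n != z by apply: contraTneq nz => ->; rewrite adj_irr.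
    by have := anti_anti_pend Nn Nz Xr nz' rn; rewrite nz.
- by rewrite na root_a P_adj.
- by rewrite ne root_e P_adj.
- by rewrite adj_sym; have /andP[] := rootP Nn.
Qed.

Lemma root_inj n n' : n != c -> ~~ adj c n -> n' != c -> ~~ adj c n' ->
  root n = root n' -> n = n'.
Proof.
have pendP z : is_pend z -> z <> b /\ z <> d.
  by move/pend_notP=> zP; split=> zE; move: zP; rewrite zE !inE eqxx !orbT.
have [_ _ bd _ _] := P_neq.
move=> nc cn nc' cn'; case: (far_cases nc cn) => [->|->|Nn];
  case: (far_cases nc' cn') => [->|->|Nn']; rewrite ?root_a ?root_e //.
- by move/eqP; rewrite (negbTE bd).
- by have /andP[/pendP[? _] _] := rootP Nn'; move/esym.
- by move/esym/eqP; rewrite (negbTE bd).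
- by have /andP[/pendP[_ ?] _] := rootP Nn'; move/esym.
- by have /andP[/pendP[? _] _] := rootP Nn.
- by have /andP[/pendP[_ ?] _] := rootP Nn.
have /andP[Xr rn] := rootP Nn; have /andP[_ rn'] := rootP Nn'.
move=> rr; rewrite -rr in rn'; apply/eqP; apply: contraLR rn' => nn'.
by have /andP[] := anti_anti_pend Nn Nn' Xr nn' rn.
Qed.

Lemma bundle_type : exists k opt, 2 <= k /\ isomorphic G (P5_bundle k opt).
Proof.
pose W := [set n | (n != c) && ~~ adj c n].
pose Y := [set y | adj c y & y \notin root @: W].
have [_ ae bd ac ec] := P_neq.
have aW : a \in W by rewrite in_set ac P_adj.
have eW : e \in W by rewrite in_set ec P_adj.
have NW n : is_anti n -> n \in W.
  move=> Nn; rewrite in_set (anti_adj Nn) andbT.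
  by apply: contraNneq (anti_notP Nn) => ->; rewrite !inE eqxx !orbT.
have YP y : y \in Y -> is_pend y /\ forall n, is_anti n -> adj n y = false.
  rewrite in_set => /andP[cy yW]; split.
    case: (near_cases cy) => // ey; case/negP: yW; rewrite ey.
      by rewrite -root_a; apply: imset_f.
    by rewrite -root_e; apply: imset_f.
  move=> n Nn; have := NW n Nn; rewrite in_set => /andP[nc cn].
  rewrite far_nbrs //; apply: contraNF yW => /eqP->; apply: imset_f; exact: NW.
have notY x : is_pend x -> x \notin Y -> exists2 n, is_anti n & adj x n.
  move=> Xx xY; have : x \in root @: W.
    by apply: contraNT xY => xW; rewrite in_set (pend_adj Xx).
  case/imsetP=> n nW xn; have := nW; rewrite in_set => /andP[nc cn].
  case: (far_cases nc cn) => [na|ne|Nn].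
  - by case/negP: (pend_notP Xx); rewrite xn na root_a !inE eqxx !orbT.
  - by case/negP: (pend_notP Xx); rewrite xn ne root_e !inE eqxx !orbT.
  - by exists n => //; rewrite adj_sym far_nbrs // xn.
(* [Y] is a module avoiding [c]: among the path vertices only [c] sees it, matched pend vertices
   miss it by [anti_pend_pend], and anti vertices miss it by [YP]. *)
have Y1 : #|Y| <= 1.
  apply/card_le1_eqP => y y' yY y'Y.
  apply: (@proper_module_eq Y y' y c) => //; last by rewrite in_set adj_irr.
  move=> z zY; case/or3P: (hanging_full z) => [/in_P zP|Xz|/andP[Nz _]].
  - by case: zP => [->|->|->|[]->]; [right|right|left|right|right] => m /YP[Xm _];
      rewrite (pend_adj Xm).
  - right=> m mY; have [Xm mN] := YP m mY.
    have [n Nn zn] := notY z Xz zY; have zm : z != m by apply: contraNneq zY => ->.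
    by have /andP[] := anti_pend_pend Nn Xz Xm zm zn.
  - by right=> m /YP[_ mN]; rewrite mN.
have [opt iso] : exists opt, isomorphic G (P5_bundle #|W| opt).
  apply: isomorphic_bundle (Y1).
  - move=> w w' cw cw'.
    have pendN x x' : is_pend x -> is_pend x' -> ~~ adj x x'.
      move=> Xx Xx'; have [->|xx'] := eqVneq x x'; first by rewrite adj_irr.
      have [xY|/(notY x Xx)[n Nn xn]] := boolP (x \in Y); last first.
        by have /andP[] := anti_pend_pend Nn Xx Xx' xx' xn.
      have [x'Y|/(notY x' Xx')[n Nn x'n]] := boolP (x' \in Y); last first.
        rewrite eq_sym in xx'; rewrite adj_sym.
        by have := anti_pend_pend Nn Xx' Xx xx' x'n => /andP[].
      by rewrite (card_le1_eqP Y1 _ _ xY x'Y) adj_irr.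
    case: (near_cases cw) => [->|->|Xw]; case: (near_cases cw') => [->|->|Xw'];
      rewrite ?P_adj ?adj_irr ?(pend_adj Xw) ?(pend_adj Xw') //.
    exact: pendN.
  - move=> n nW; have := nW; rewrite in_set => /andP[nc cn]; split.
      by case: (far_cases nc cn) => [->|->|/rootP/andP[Xr _]];
        rewrite ?root_a ?root_e ?P_adj ?(pend_adj Xr).
    by move=> z; apply: far_nbrs.
  - by move=> n n'; rewrite !in_set => /andP[? ?] /andP[? ?]; apply: root_inj.
exists #|W|, opt; split=> //.
(* The fixed path already provides two arms, ending in [a] and [e]. *)
have <- : #|[set a; e]| = 2 by rewrite cards2 ae.
by apply/subset_leq_card/subsetP => z; rewrite in_set2 => /orP[]/eqP->.
Qed.
End Bundle.

(** * Some pend vertex misses some full vertex: the second type *)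

Section Second.
Variables x0 t0 : G.
Hypotheses (Xx0 : is_pend x0) (Tt0 : is_full t0) (x0t0 : ~~ adj x0 t0).

Lemma paired_full z :
  [|| z \in P, is_pend z | is_full z && [exists x, is_pend x && ~~ adj x z]].
Proof.
pose M := [set z | [|| z \in P, is_pend z | is_full z && [exists x, is_pend x && ~~ adj x z]]].
suff : z \in M by rewrite inE.
have aM : a \in M by rewrite in_set mem_head.
have bM : b \in M by rewrite in_set !inE eqxx orbT.
have [ab _ _ _ _] := P_neq; apply: (large_module_full _ aM bM ab) => {}z.
rewrite in_set => zM.
have zP : z \notin P by apply: contra zM => ->.
have zX : is_pend z = false by apply: contraNF zM => ->; rewrite orbT.
have zT x : is_full z -> is_pend x -> adj x z.
  move=> Tz Xx; apply: contraR zM => xz; rewrite Tz /= orbC.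
  by apply/orP; left; apply/orP; right; apply/existsP; exists x; rewrite Xx.
case/or3P: (type_cases zP) => [Nz|Xz|Tz].
- right=> m; rewrite in_set => /or3P[/in_P mP|Xm|/andP[Tm /existsP[x /andP[Xx xm]]]].
  + by case: mP => [->|->|->|[]->]; rewrite (anti_adj Nz).
  (* An anti vertex seeing any pend vertex sees [t0], and then [x0] would see [t0] as well. *)
  + apply: contra x0t0; rewrite adj_sym => mz.
    have /andP[zt0 _] := anti_pend_full Nz Xm Tt0; have /andP[_] := anti_pend_full Nz Xx0 Tt0.
    by move/implyP; apply; move/implyP: zt0; apply.
  + by have /andP[_ /implyP zx] := anti_pend_full Nz Xx Tm; apply: contra xm.
- by rewrite Xz in zX.
- left=> m; rewrite in_set => /or3P[/in_P mP|Xm|/andP[Tm /existsP[x /andP[Xx xm]]]].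
  + by case: mP => [->|->|->|[]->]; rewrite (full_adj Tz).
  + by rewrite adj_sym zT.
  + have mz : m != z by apply: contraTneq (zT x Tz Xx) => <-.
    by rewrite adj_sym; have /andP[] := pend_full_full Xx Tm Tz mz xm.
Qed.

(** Another full vertex misses some pend vertex by [paired_full]; this contradicts [pend_full_full]
    if that vertex is [x0], and [nonadjacent_pairs] otherwise. *)
Lemma full_unique z : is_full z -> z = t0.
Proof.
move=> Tz; apply/eqP; apply: contraT; rewrite eq_sym => tz.
case/or3P: (paired_full z) => [zP|Xz|/andP[_ /existsP[x /andP[Xx xz]]]].
- by case/negP: (full_notP Tz).
- by have := (pend_full Xz Tz).1; rewrite eqxx.
have [xx|xx] := eqVneq x0 x.
  by have /andP[] := pend_full_full Xx0 Tt0 Tz tz x0t0; rewrite xx (negbTE xz).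
by have := nonadjacent_pairs Xx0 Xx Tt0 Tz xx tz; rewrite (negbTE xz) (negbTE x0t0).
Qed.

Lemma second_cases z : [\/ z \in P, is_pend z | z = t0].
Proof.
case/or3P: (paired_full z) => [zP|Xz|/andP[/full_unique zt _]].
- exact: Or31.
- exact: Or32.
- exact: Or33.
Qed.

Lemma other_pend x : is_pend x -> x != x0 -> adj x0 x && adj x t0.
Proof. by rewrite eq_sym => Xx xx; apply: pend_pend_full. Qed.

Lemma second_type : exists opt, isomorphic G (second_graph opt).
Proof.
pose Y := [set x | is_pend x & x != x0].
(* [Y] is a module avoiding [c]: [c], [x0] and [t0] see all of it, the rest of the path none. Its
   only possible element is the optional x. *)
have Y1 x y : x \in Y -> y \in Y -> x = y.
  apply: (@proper_module_eq Y x y c); last first.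
    by rewrite in_set; apply/negP=> /andP[/pend_notP]; rewrite !inE eqxx !orbT.
  move=> z zY; case: (second_cases z) => [/in_P zP|Xz|->].
  - by case: zP => [->|->|->|[]->]; [right|right|left|right|right] => m;
      rewrite in_set => /andP[Xm _]; rewrite (pend_adj Xm).
  - left=> m; rewrite in_set => /andP[Xm mx].
    have -> : z = x0 by apply/eqP; apply: contraNT zY; rewrite in_set Xz.
    by have /andP[] := other_pend Xm mx.
  - by left=> m; rewrite in_set adj_sym => /andP[Xm mx]; have /andP[] := other_pend Xm mx.
have x0t : x0 != t0 := (pend_full Xx0 Tt0).1.
case: (pickP (mem Y)) => [x xY|Y0].
  exists true; have := xY; rewrite /= in_set => /andP[Xx xx].
  have /andP[x0x xt] := other_pend Xx xx.
  (* The order follows the numbering of [second_graph]: x0, t0, x are 5, 6, 7. *)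
  apply: (@edges_iso _ a (P ++ [:: x0; t0; x])).
  - apply: uniq_typed; last by rewrite /= /typed Xx Xx0 Tt0 ?orbT.
    by rewrite /= !inE !negb_or x0t (pend_full Xx Tt0) eq_sym xx.
  - move=> z; rewrite mem_cat; case: (second_cases z) => [->//|Xz|->].
      have [->|zx] := eqVneq z x0; first by rewrite mem_head orbT.
      have -> : z = x by apply: Y1 => //; rewrite in_set Xz.
      by rewrite !inE eqxx !orbT.
    by rewrite !inE eqxx !orbT.
  - rewrite /adj_table lower_rows_cat rowsP /= !(pend_adj Xx) !(pend_adj Xx0) !(full_adj Tt0).
    by rewrite x0x (adj_sym t0) xt (negbTE x0t0).
exists false; apply: (@edges_iso _ a (P ++ [:: x0; t0])).
- apply: uniq_typed; last by rewrite /= /typed Xx0 Tt0 ?orbT.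
  by rewrite /= !inE x0t.
- move=> z; rewrite mem_cat; case: (second_cases z) => [->//|Xz|->].
    have [->|zx] := eqVneq z x0; first by rewrite mem_head orbT.
    by have := Y0 z; rewrite /= in_set Xz zx.
  by rewrite !inE eqxx !orbT.
- rewrite /adj_table lower_rows_cat rowsP /= !(pend_adj Xx0) !(full_adj Tt0).
  by rewrite (negbTE x0t0).
Qed.
End Second.

Lemma prime_sparse_types : of_two_types G.
Proof.
case: (boolP [exists x, exists t, [&& is_pend x, is_full t & ~~ adj x t]]) => [|nXT].
  by case/existsP=> x /existsP[t /and3P[Xx Tt xt]]; right; apply: second_type xt.
left; apply: bundle_type => x t Xx Tt; apply: contraR nXT => xt.
by apply/existsP; exists x; apply/existsP; exists t; apply/and3P.
Qed.
End PrimeSparse.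

(** * The characterisation and its complementary form *)

Lemma P5_sparse_types (G : sgraph) : prime_graph G -> contains_induced G P5 ->
  P5_coP5_Bull_sparse G <-> of_two_types G.
Proof.
move=> pG /contains_P5P[a [b [c [d [e [uniqP rowsP]]]]]]; split; last exact: of_two_types_sparse.
by move=> sG; apply: prime_sparse_types uniqP rowsP.
Qed.

Theorem theorem3p2 (G : sgraph) (Gprime : prime_graph G) (GC5 : C5_free G) :
  (contains_induced G P5 ->
     (P5_coP5_Bull_sparse G <-> of_two_types G)) /\
  (contains_induced G (compl P5) ->
     (P5_coP5_Bull_sparse G <-> of_two_types (compl G))).
Proof.
split; first exact: P5_sparse_types.
case=> A iso; have P5C : contains_induced (compl G) P5.
  exists A; apply: isomorphic_trans (isomorphic_compl_compl P5).
  apply: isomorphic_trans (isomorphic_compl iso).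
  exact/isomorphic_sym/isomorphic_induced_compl.
have [types sparse] := P5_sparse_types (prime_compl Gprime) P5C.
split=> [sG|/sparse sG]; first by apply: types; apply: sparse_compl.
exact: sparse_complI.
Qed.
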